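(* For all integers $n\geq 0$, $$a_{1^{2}2^{-1}5^{-2}}(5n)>0,\quad a_{1^{2}2^{-1}5^{-2}}(5n+1)<0,\quad a_{1^{2}2^{-1}5^{-2}}(5n+2)=0,$$ $$a_{1^{2}2^{-1}5^{-2}}(5n+3)=0,\quad a_{1^{2}2^{-1}5^{-2}}(5n+4)>0.$$
   Context: For $|q|<1$ (or as formal power series in $q$) let $f_j:=(q^j;q^j)_\infty=\prod_{k\ge 1}(1-q^{jk})$ for each positive integer $j$. The integers $a_{1^{2}2^{-1}5^{-2}}(n)$, $n\ge 0$, are defined by $\sum_{n=0}^\infty a_{1^{2}2^{-1}5^{-2}}(n)q^n=\dfrac{f_1^2}{f_2f_5^2}$. *)

(* Defs.v *)
(* Formal power series in q over the integers are represented
   by their coefficient sequences [nat -> int]. *)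
From mathcomp Require Import all_boot all_order all_algebra.

Set Implicit Arguments.
Unset Strict Implicit.
Unset Printing Implicit Defensive.

Import Order.TTheory GRing.Theory Num.Theory.
Local Open Scope ring_scope.

Definition fps := nat -> int.

Definition fps_one : fps := fun n => (n == 0)%:R.

Definition fps_mul (a b : fps) : fps :=
  fun n => \sum_(i < n.+1) a i * b (n - i)%N.

Definition fps_exp (a : fps) (k : nat) : fps := iter k (fps_mul a) fps_one.

(* Inverse of a series a with constant term 1, as the geometric series
   \sum_k (1 - a)^k.  Since (1 - a)^k is divisible by q^k, the terms k > n do
   not contribute to the coefficient of q^n.  Not meaningful when a 0 <> 1;
   see [fps_mulV]. *)
Definition fps_inv (a : fps) : fps :=
  fun n => \sum_(k < n.+1) fps_exp (fun m => fps_one m - a m) k n.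

Definition fps_div (a b : fps) : fps := fps_mul a (fps_inv b).

(* f_j = (q^j; q^j)_oo = \prod_(k >= 1) (1 - q^(j k)), for j >= 1.  The factors
   with k > n do not affect the coefficient of q^n, so this coefficient is read
   off from the finite product over 1 <= k <= n; see [qpoch_stable]. *)
Definition qpoch (j : nat) : fps :=
  fun n => (\prod_(1 <= k < n.+1) (1 - 'X^(j * k)) : {poly int})`_n.

(* a_{1^2 2^{-1} 5^{-2}}(n): the coefficients of f_1^2 / (f_2 f_5^2). *)
Definition a_12_2m1_5m2 : fps :=
  fps_div (fps_exp (qpoch 1) 2) (fps_mul (qpoch 2) (fps_exp (qpoch 5) 2)).

Lemma qpoch_stable (j n N : nat) : (0 < j)%N -> (n <= N)%N ->
  (\prod_(1 <= k < N.+1) (1 - 'X^(j * k)) : {poly int})`_n = qpoch j n.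
Proof.
move=> j_gt0; elim: N => [|N IHN]; first by rewrite leqn0 => /eqP ->.
rewrite leq_eqVlt => /orP[/eqP -> //|]; rewrite ltnS => le_nN.
rewrite big_nat_recr //= mulrBr mulr1 coefB coefMXn IHN //.
by rewrite ifT ?subr0 // (leq_trans (le_nN : (n < N.+1)%N)) ?leq_pmull.
Qed.

Lemma qpoch0 (j : nat) : qpoch j 0 = 1.
Proof. by rewrite /qpoch big_geq // coef1. Qed.

Lemma fps_mul0 (a b : fps) : fps_mul a b 0 = a 0%N * b 0%N.
Proof. by rewrite /fps_mul big_ord_recl big_ord0 addr0. Qed.

Lemma fps_mul1s (a : fps) (n : nat) : fps_mul fps_one a n = a n.
Proof.
rewrite /fps_mul big_ord_recl big1 => [|i _]; last by rewrite mul0r.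
by rewrite mul1r subn0 addr0.
Qed.

Lemma fps_exp_low (u : fps) (k n : nat) :
  u 0%N = 0 -> (n < k)%N -> fps_exp u k n = 0.
Proof.
move=> u0; elim: k n => // k IHk n lt_nk; rewrite /fps_exp iterS /fps_mul.
rewrite big_ord_recl u0 mul0r add0r big1 // => i _.
rewrite -/(fps_exp u k) IHk ?mulr0 // lift0.
rewrite ltnS in lt_nk; apply: leq_trans lt_nk.
by rewrite ltn_subrL (leq_ltn_trans _ (ltn_ord i)).
Qed.

Lemma fps_mulV (a : fps) (n : nat) :
  a 0%N = 1 -> fps_mul a (fps_inv a) n = fps_one n.
Proof.
move=> a0; pose u : fps := fun m => fps_one m - a m.
have u0 : u 0%N = 0 by rewrite /u a0 subrr.
have invE m : (m <= n)%N -> fps_inv a m = \sum_(k < n.+1) fps_exp u k m.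
  move=> le_mn; rewrite /fps_inv -/u.
  rewrite (big_ord_widen n.+1 (fun k => fps_exp u k m)) //.
  rewrite [RHS](bigID (fun k : 'I_n.+1 => (k < m.+1)%N)) /=.
  rewrite [X in _ + X]big1 ?addr0 // => k; rewrite -leqNgt => lt_mk.
  exact: fps_exp_low.
transitivity (\sum_(k < n.+1) fps_mul a (fps_exp u k) n).
  rewrite /fps_mul exchange_big; apply: eq_bigr => i _.
  by rewrite invE ?leq_subr // mulr_sumr.
transitivity (\sum_(0 <= k < n.+1) - (fps_exp u k.+1 n - fps_exp u k n)).
  rewrite big_mkord; apply: eq_bigr => k _; rewrite opprB.
  rewrite -[fps_exp u k n]fps_mul1s /fps_exp iterS -/(fps_exp u k).
  rewrite /fps_mul -sumrB; apply: eq_bigr => i _.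
  by rewrite -mulrBl /u opprB addrC subrK.
by rewrite sumrN telescope_sumr // opprB (@fps_exp_low u n.+1) // subr0.
Qed.

(* The denominator f_2 f_5^2 meets the hypothesis of [fps_mulV]. *)
Lemma eta_denominator0 : fps_mul (qpoch 2) (fps_exp (qpoch 5) 2) 0 = 1.
Proof. by rewrite /fps_exp /= !fps_mul0 !qpoch0. Qed.

(* Main.v *)
(* By Jacobi's triple product, f_1^2/f_2 = \sum_n (-1)^n q^(n^2) over all
   integers n.  Sorting n by its residue mod 5, this series is
     T(5,5)(q^5) - 2 q T(3,7)(q^5) + 2 q^4 T(1,9)(q^5),
   where T(p,q) is Ramanujan's theta function f(-x^p, -x^q), and dividing by
   f_5^2 = f_1(q^5)^2 respects this dissection: residues 2 and 3 do not occur,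
   and the other three sections are T(p,q)/f_1^2 up to the factors 1, -2, 2.
   By the triple product again, T(p,q) with p + q = 10 is the product of the
   1 - x^k with k = p, q, 0 mod 10.  All these factors cancel against f_1^2, and
   a factor 1 - x remains in the denominator, so that all coefficients of the
   quotient are positive.
   Series are handled as polynomials modulo x^K. *)
Require Import Defs.
From mathcomp Require Import all_boot all_order all_algebra.
From mathcomp Require Import zify ring.

Set Implicit Arguments.
Unset Strict Implicit.
Unset Printing Implicit Defensive.

Import Order.TTheory GRing.Theory Num.Theory.
Local Open Scope ring_scope.

(** * Gaussian binomials and the finite triple product *)

Section QBinomial.
Variables (R : comNzRingType) (Q : R).

(** The Gaussian binomial, by a Pascal rule instead of a quotient, so that it exists in any
    commutative ring. *)
Fixpoint qbin (n j : nat) : R :=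
  match n, j with
  | _, 0 => 1
  | 0, _.+1 => 0
  | n'.+1, j'.+1 => qbin n' j'.+1 + Q ^+ (n' - j') * qbin n' j'
  end.

Arguments qbin : simpl never.

Definition qfact (n : nat) : R := \prod_(k < n) (1 - Q ^+ k.+1).

Lemma qbin0 n : qbin n 0 = 1. Proof. by case: n. Qed.

Lemma qbinS n j : qbin n.+1 j.+1 = qbin n j.+1 + Q ^+ (n - j) * qbin n j.
Proof. by []. Qed.

Lemma qbin_small n j : (n < j)%N -> qbin n j = 0.
Proof.
elim: n j => [|n IHn] [|j] // lt_nj; rewrite qbinS.
by rewrite !IHn ?mulr0 ?addr0 // ltnW.
Qed.

(** The mirror Pascal rule: [finite_jacobi] uses [qbinS] to raise M and this one to raise N. *)
Lemma qbinS_alt n j : qbin n.+1 j.+1 = qbin n j + Q ^+ j.+1 * qbin n j.+1.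
Proof.
elim: n j => [|n IHn] j.
  by rewrite qbinS !(@qbin_small 0 j.+1) // sub0n mulr0 addr0 add0r mul1r.
case: (ltnP n j) => [lt_nj|le_jn].
  by rewrite qbinS !(qbin_small (j := j.+1)) ?mulr0 ?addr0 ?add0r //
    (eqP (_ : n.+1 - j == 0)%N) ?mul1r // subn_eq0.
rewrite qbinS {1}IHn; case: j le_jn => [|j] le_jn.
  rewrite [in RHS]qbinS !qbin0 !subn0 !exprS; ring.
rewrite [X in _ + _ * X]IHn subSS !qbinS.
have ->: (n - j = (n - j.+1).+1)%N by lia.
rewrite !exprS; ring.
Qed.

Lemma qfactS n : qfact n.+1 = qfact n * (1 - Q ^+ n.+1).
Proof. by rewrite /qfact big_ord_recr. Qed.

Lemma qbin_fact n j : (j <= n)%N ->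
  qbin n j * (qfact j * qfact (n - j)) = qfact n.
Proof.
elim: n j => [|n IHn] [|j] // le_jn; rewrite ?qbin0 ?subn0 ?mul1r.
- by rewrite /qfact big_ord0 !mul1r.
- by rewrite /qfact big_ord0 !mul1r.
rewrite subSS qbinS; move: le_jn; rewrite ltnS leq_eqVlt.
case/orP=> [/eqP->|lt_jn].
  have := IHn n (leqnn n).
  rewrite (@qbin_small n n.+1) // subnn !qfactS => E.
  rewrite -[X in _ = X * _]E; ring.
have ej : (n - j = (n - j.+1).+1)%N by lia.
have := IHn _ lt_jn; have := IHn _ (ltnW lt_jn).
rewrite ej !qfactS => E1 E2.
transitivity (qfact n * (1 - Q ^+ (n - j.+1).+1)
   + Q ^+ (n - j.+1).+1 * (qfact n * (1 - Q ^+ j.+1))).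
  rewrite -[in X in _ = X + _]E2 -[in X in _ = _ + X]E1; ring.
have ->: Q ^+ n.+1 = Q ^+ (n - j.+1).+1 * Q ^+ j.+1.
  by rewrite -exprD; congr (_ ^+ _); lia.
ring.
Qed.

End QBinomial.
Arguments qbin : simpl never.

Section FiniteJacobi.
Variables (R : comNzRingType) (u v : R).

(* With n = j - N, the term (-1)^n u^(n(n-1)/2) v^(n(n+1)/2) of Ramanujan's
   f(-u, -v); the case split keeps the exponents in nat when n < 0. *)
Definition theta_coef (N j : nat) : R :=
  if (j < N)%N then (-1) ^+ (N - j) * u ^+ 'C((N - j).+1, 2) * v ^+ 'C(N - j, 2)
  else (-1) ^+ (j - N) * u ^+ 'C(j - N, 2) * v ^+ 'C((j - N).+1, 2).

Lemma binS2 n : ('C(n.+1, 2) = 'C(n, 2) + n)%N.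
Proof. by rewrite binS bin1. Qed.

Lemma theta_coefSS N j : theta_coef N.+1 j.+1 = theta_coef N j.
Proof. by rewrite /theta_coef ltnS !subSS. Qed.

Lemma theta_coefL j t :
  theta_coef (j + t) j = (-1) ^+ t * u ^+ 'C(t.+1, 2) * v ^+ 'C(t, 2).
Proof.
rewrite /theta_coef; case: t => [|t]; first by rewrite addn0 ltnn subnn.
by rewrite addnS ltnS leq_addr -addnS addKn.
Qed.

Lemma theta_coefR N s :
  theta_coef N (N + s) = (-1) ^+ s * u ^+ 'C(s, 2) * v ^+ 'C(s.+1, 2).
Proof. by rewrite /theta_coef ltnNge leq_addr addKn. Qed.

(** The power of [u * v] produced by [qbinS] shifts the index and becomes the new factor's term
    [- v * (u * v) ^+ M]. [theta_coef_recl] plays this role for [qbinS_alt]. *)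
Lemma theta_coef_recr N M j : (j <= N + M)%N ->
  theta_coef N j.+1 * (u * v) ^+ (N + M - j)
  = - (theta_coef N j * (v * (u * v) ^+ M)).
Proof.
move=> le_j; case: (leqP N j) => [le_Nj|lt_jN].
  have [s ej] : exists s, j = (N + s)%N by exists (j - N)%N; lia.
  have [t eM] : exists t, M = (s + t)%N by exists (M - s)%N; lia.
  rewrite ej eM -addnS !theta_coefR addnA addKn.
  rewrite (binS2 s.+1) (binS2 s) !exprMn !exprD !exprS; ring.
have [t eN] : exists t, N = (j + t.+1)%N by exists (N - j).-1; lia.
rewrite eN theta_coefL addnS -addSn theta_coefL.
have ->: (j.+1 + t + M - j = t.+1 + M)%N by lia.
rewrite (binS2 t.+1) (binS2 t) !exprMn !exprD !exprS; ring.
Qed.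

Lemma theta_coef_recl N j :
  theta_coef N j * (u * v) ^+ j.+1 = - (theta_coef N j.+1 * (u * (u * v) ^+ N)).
Proof.
case: (leqP N j) => [le_Nj|lt_jN].
  have [s ->] : exists s, j = (N + s)%N by exists (j - N)%N; lia.
  rewrite -addnS !theta_coefR.
  rewrite (binS2 s.+1) (binS2 s) !exprMn !exprD !exprS; ring.
have [t eN] : exists t, N = (j + t.+1)%N by exists (N - j).-1; lia.
rewrite eN theta_coefL addnS -addSn theta_coefL.
rewrite (binS2 t.+1) (binS2 t) !exprMn !exprD !exprS; ring.
Qed.

(** Factors are added one at a time, those in u first: a Pascal rule splits the new sum into the old
    one and its multiple by the second term of the new factor. *)
Lemma finite_jacobi N M :
  (\prod_(k < N) (1 - u * (u * v) ^+ k)) * \prod_(k < M) (1 - v * (u * v) ^+ k)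
  = \sum_(j < (N + M).+1) theta_coef N j * qbin (u * v) (N + M) j.
Proof.
set Q := u * v; elim: M => [|M IHM].
  rewrite big_ord0 mulr1 addn0; elim: N => [|N IHN].
    by rewrite big_ord0 big_ord_recl big_ord0 /= addr0 mulr1 /theta_coef
               !expr0 !mulr1.
  have dropN : \sum_(j < N.+1) theta_coef N j * qbin Q N j
             = \sum_(j < N.+2) theta_coef N j * qbin Q N j.
    by rewrite [RHS]big_ord_recr /= qbin_small // mulr0 addr0.
  rewrite big_ord_recr IHN /= mulrBr mulr1 [RHS]big_ord_recl.
  under [in RHS]eq_bigr => i _ do
    rewrite lift0 theta_coefSS qbinS_alt mulrDr mulrA theta_coef_recl -/Q.
  rewrite big_split /= addrCA; congr (_ + _).
  rewrite dropN mulr_suml -sumrN big_ord_recl /= !qbin0; congr (_ + _).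
    have := theta_coefL 0 N.+1; rewrite add0n => ->.
    have := theta_coefL 0 N; rewrite add0n => ->.
    rewrite (binS2 N.+1) (binS2 N) /Q !exprMn !exprD !exprS; ring.
  by apply: eq_bigr => i _; rewrite mulNr mulrAC.
have dropNM : \sum_(j < (N + M).+1) theta_coef N j * qbin Q (N + M) j
            = \sum_(j < (N + M).+2) theta_coef N j * qbin Q (N + M) j.
  by rewrite [RHS]big_ord_recr /= qbin_small // mulr0 addr0.
rewrite big_ord_recr mulrA IHM /= mulrBr mulr1 addnS [RHS]big_ord_recl.
under [in RHS]eq_bigr => i _ do
  rewrite lift0 qbinS mulrDr mulrA (theta_coef_recr (ltnSE (ltn_ord i))) -/Q.
rewrite big_split /= addrA; congr (_ + _).
  by rewrite dropNM [LHS]big_ord_recl /= !qbin0.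
by rewrite mulr_suml -sumrN; apply: eq_bigr => i _; rewrite mulNr mulrAC.
Qed.
(** Partial sum over |n| <= N of Ramanujan's f(-u, -v), with n and -n paired. *)
Definition theta (N : nat) : R :=
  1 + \sum_(i < N) (-1) ^+ i.+1 *
    (u ^+ 'C(i.+2, 2) * v ^+ 'C(i.+1, 2) + u ^+ 'C(i.+1, 2) * v ^+ 'C(i.+2, 2)).

Lemma thetaS N : theta N.+1 = theta N + (-1) ^+ N.+1 *
  (u ^+ 'C(N.+2, 2) * v ^+ 'C(N.+1, 2) + u ^+ 'C(N.+1, 2) * v ^+ 'C(N.+2, 2)).
Proof. by rewrite /theta big_ord_recr /= addrA. Qed.

Lemma sum_theta_coef N : \sum_(j < (N + N).+1) theta_coef N j = theta N.
Proof.
elim: N => [|N IHN].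
  by rewrite big_ord_recl big_ord0 /theta big_ord0 /theta_coef !expr0 !mulr1.
rewrite addSn addnS big_ord_recl big_ord_recr /=.
under eq_bigr => j _ do rewrite theta_coefSS.
rewrite IHN thetaS /bump /= add1n.
have := theta_coefL 0 N.+1; have := theta_coefR N.+1 N.+1.
rewrite add0n addSn addnS => -> ->; ring.
Qed.
End FiniteJacobi.

Lemma theta_rmorph (R S : comNzRingType) (f : {rmorphism R -> S}) u v N :
  f (theta u v N) = theta (f u) (f v) N.
Proof.
rewrite /theta rmorphD rmorph1 rmorph_sum; congr (_ + _); apply: eq_bigr => i _.
by rewrite rmorphM rmorphD !rmorphM !rmorphXn rmorphN1.
Qed.

(** * Truncation modulo a power of the variable *)

Definition eqpX (K : nat) (p q : {poly int}) : Prop :=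
  forall i, (i < K)%N -> p`_i = q`_i.

Lemma eqpXW K L p q : (L <= K)%N -> eqpX K p q -> eqpX L p q.
Proof. by move=> le_LK e i lt_iL; apply: e; apply: leq_trans le_LK. Qed.

Lemma eqpX_refl K p : eqpX K p p. Proof. by []. Qed.

Lemma eqpX_sym K p q : eqpX K p q -> eqpX K q p.
Proof. by move=> e i lt_iK; rewrite e. Qed.

Lemma eqpX_trans K q p r : eqpX K p q -> eqpX K q r -> eqpX K p r.
Proof. by move=> e e' i lt_iK; rewrite e ?e'. Qed.

Lemma eqpXM K p p' q q' :
  eqpX K p p' -> eqpX K q q' -> eqpX K (p * q) (p' * q').
Proof.
move=> ep eq i lt_iK; rewrite !coefM; apply: eq_bigr => j _.
by rewrite ep ?eq // (leq_ltn_trans _ lt_iK) ?leq_subr // -ltnS.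
Qed.

Lemma eqpX_sum K (I : Type) (r : seq I) (F G : I -> {poly int}) :
  (forall i, eqpX K (F i) (G i)) ->
  eqpX K (\sum_(i <- r) F i) (\sum_(i <- r) G i).
Proof.
by move=> e i lt_iK; rewrite !coef_sum; apply: eq_bigr => j _; apply: e.
Qed.

Lemma eqpX_mulXn K L p q : eqpX K p q -> eqpX (L + K) ('X^L * p) ('X^L * q).
Proof.
move=> e i lt_i; rewrite !coefXnM; case: ltnP => // le_Li.
by apply: e; rewrite ltn_subLR.
Qed.

(** As [u] has constant term 1, each coefficient of [p * u] is that of [p] plus terms in lower
    coefficients of [p]. *)
Lemma eqpX_cancel K (u p q : {poly int}) :
  u`_0 = 1 -> eqpX K (p * u) (q * u) -> eqpX K p q.
Proof.
move=> u0 e; elim/ltn_ind => i IHi lt_iK; have := e i lt_iK.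
rewrite !coefM !big_ord_recr /= subnn u0 !mulr1.
suff -> : \sum_(j < i) p`_j * u`_(i - j) = \sum_(j < i) q`_j * u`_(i - j).
  by move/addrI.
by apply: eq_bigr => j _; rewrite IHi // (ltn_trans _ lt_iK).
Qed.

Lemma coef0_1subXn k : (0 < k)%N -> (1 - 'X^k : {poly int})`_0 = 1.
Proof. by case: k => // k _; rewrite coefB coef1 coefXn subr0. Qed.

Lemma coef0_qfact d n : (0 < d)%N -> (qfact ('X^d : {poly int}) n)`_0 = 1.
Proof.
move=> d_gt0; rewrite coef0_prod big1 // => i _.
by rewrite -exprM coef0_1subXn ?muln_gt0 ?d_gt0.
Qed.

Lemma eqpX_1subXn K k (p : {poly int}) :
  (K <= k)%N -> eqpX K (p * (1 - 'X^k)) p.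
Proof.
move=> le_Kk i lt_iK.
by rewrite mulrBr mulr1 coefB coefMXn (leq_trans lt_iK le_Kk) subr0.
Qed.

Lemma qfact_eqpX d s n : (s <= n)%N ->
  eqpX (d * s.+1) (qfact 'X^d n) (qfact 'X^d s).
Proof.
elim: n => [|n IHn]; first by rewrite leqn0 => /eqP->.
rewrite leq_eqVlt => /orP[/eqP-> //|]; rewrite ltnS => le_sn.
apply: eqpX_trans (IHn le_sn); rewrite qfactS -exprM.
by apply: eqpX_1subXn; rewrite leq_mul2l ltnS le_sn orbT.
Qed.

(** In [qbin_fact] all q-factorials have order at least [s], so each agrees with [qfact 'X^d s] to
    the stated precision, and one of them cancels. *)
Lemma qbin_eqpX d N s j : (0 < d)%N -> (s <= N)%N -> (s <= j)%N ->
  (j + s <= N + N)%N ->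
  eqpX (d * s.+1) (qbin 'X^d (N + N) j * qfact 'X^d N) 1.
Proof.
move=> d_gt0 le_sN le_sj le_js; set Q := 'X^d.
apply: (@eqpX_cancel _ (qfact Q s)); first exact: coef0_qfact.
rewrite mul1r.
have eqQ n : (s <= n)%N -> eqpX (d * s.+1) (qfact Q s) (qfact Q n).
  by move=> le_sn; apply/eqpX_sym/qfact_eqpX.
have le_jN : (j <= N + N)%N by lia.
apply: (@eqpX_trans _ (qbin Q (N + N) j * (qfact Q j * qfact Q (N + N - j)))).
  rewrite -mulrA; apply: eqpXM => //; apply: eqpXM; last by apply: eqQ; lia.
  by apply: eqpX_trans (eqQ _ le_sj); apply/eqpX_sym/eqQ.
by rewrite qbin_fact //; apply/eqpX_sym/eqQ; lia.
Qed.

(** Subtraction being truncated, [(j - N) + (N - j)] is the distance from j to the centre N. *)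
Lemma theta_coef_factor p q N j : exists e : {poly int},
  theta_coef 'X^p 'X^q N j = 'X^((p + q) * 'C((j - N) + (N - j), 2)) * e.
Proof.
case: (leqP N j) => [le_Nj|lt_jN].
  have [s ->] : exists s, j = (N + s)%N by exists (j - N)%N; lia.
  rewrite theta_coefR addKn subnDA subnn addn0.
  exists ((-1) ^+ s * 'X^(q * s)).
  rewrite binS2 -!exprM mulrCA -exprD -mulrA -exprD; congr (_ * 'X^_); lia.
have [t ->] : exists t, N = (j + t)%N by exists (N - j)%N; lia.
rewrite theta_coefL addKn subnDA subnn add0n.
exists ((-1) ^+ t * 'X^(p * t)).
rewrite binS2 -!exprM mulrCA -exprD -mulrA -exprD; congr (_ * 'X^_); lia.
Qed.

Lemma leq_bin2 n : (n <= 'C(n, 2).+1)%N.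
Proof. by elim: n => // n IHn; rewrite binS2; case: n IHn => // n; lia. Qed.

(** The term at distance n from the centre is divisible by x^((p+q) C(n,2)), and its binomial times
    [qfact] is 1 modulo x^((p+q)(N-n+1)). Since C(n,2) + 1 >= n, the errors start at degree N or
    later. *)
Lemma jacobi_eqpX p q N : (0 < p)%N -> eqpX N
  (\prod_(k < N) ((1 - 'X^p * 'X^(p + q) ^+ k) * (1 - 'X^q * 'X^(p + q) ^+ k)
                  * (1 - 'X^(p + q) ^+ k.+1)))
  (theta 'X^p 'X^q N).
Proof.
move=> p_gt0; rewrite !big_split /= -/(qfact _ N).
have eQ : 'X^(p + q) = 'X^p * 'X^q :> {poly int} by rewrite exprD.
rewrite eQ finite_jacobi -eQ mulr_suml -sum_theta_coef.
apply: eqpX_sum => j; rewrite -mulrA -[X in eqpX _ _ X]mulr1.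
have [e ->] := theta_coef_factor p q N j.
rewrite -!mulrA; set n := (_ - _ + (_ - _))%N.
have le_nN : (n <= N)%N by have := ltn_ord j; lia.
apply: (@eqpXW ((p + q) * 'C(n, 2) + (p + q) * (N - n).+1)).
  rewrite -mulnDr; have := leq_bin2 n; nia.
apply: eqpX_mulXn; apply: eqpXM => //.
by apply: qbin_eqpX; have := ltn_ord j; lia.
Qed.

(** * The dissection of theta modulo 5 *)

Lemma bin2_5mul M c :
  'C(c + 5 * M, 2) = (25 * 'C(M, 2) + (10 + 5 * c) * M + 'C(c, 2))%N.
Proof.
elim: c => [|c IHc]; last by rewrite addSn !binS2 IHc; lia.
elim: M => [|M IHM] //.
have -> : (0 + 5 * M.+1 = (0 + 5 * M).+4.+1)%N by lia.
by rewrite !binS2 IHM bin0n; lia.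
Qed.

(** The range |n| <= 5M + 2 consists exactly of the n = 5m + r with |m| <= M and |r| <= 2, so the
    identity holds without truncation. In n^2 = 25m^2 + 10mr + r^2, opposite values of r give the
    same sum, whence the factors 2. *)
Lemma theta_dissection M :
  theta 'X 'X (5 * M).+2 = theta 'X^25 'X^25 M - 'X *+ 2 * theta 'X^15 'X^35 M
    + 'X^4 *+ 2 * theta 'X^5 'X^45 M :> {poly int}.
Proof.
elim: M => [|M IHM].
  by rewrite muln0 !thetaS /theta !big_ord0 -!exprD !binS2 bin0n /=; ring.
have -> : (5 * M.+1).+2 = (5 * M).+4.+3 by lia.
rewrite 5!thetaS IHM !thetaS.
have sgnE c : (-1) ^+ (c + 5 * M) = (-1) ^+ c * (-1) ^+ M :> {poly int}.
  by rewrite exprD exprM -[in X in _ * X ^+ _]signr_odd expr1.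
have binE c := bin2_5mul M c.
rewrite -[(5 * M).+3]/(3 + 5 * M)%N -[(5 * M).+4]/(4 + 5 * M)%N.
rewrite -[(3 + 5 * M).+2]/(5 + 5 * M)%N -[(4 + 5 * M).+2]/(6 + 5 * M)%N.
rewrite -[(4 + 5 * M).+3]/(7 + 5 * M)%N -[(4 + 5 * M).+4]/(8 + 5 * M)%N.
rewrite -!exprM -!exprD.
have ea : 'C(M.+2, 2) = ('C(M, 2) + M + M.+1)%N by rewrite !binS2.
have eb : 'C(M.+1, 2) = ('C(M, 2) + M)%N by rewrite !binS2.
move: 'C(M.+2, 2) 'C(M.+1, 2) ea eb => a b ea eb.
(* The left sides are the squares of 5M + 3, ..., 5M + 7; the right sides are the exponents of the
   last terms of the three thetas, prefactors included. *)
have e3 : ('C(3 + 5 * M, 2) + 'C(4 + 5 * M, 2) = 4 + (5 * a + 45 * b))%N.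
  by rewrite !binE ea eb !binS2 bin0n; lia.
have e4 : ('C(4 + 5 * M, 2) + 'C(5 + 5 * M, 2) = 1 + (15 * a + 35 * b))%N.
  by rewrite !binE ea eb !binS2 bin0n; lia.
have e5 : ('C(5 + 5 * M, 2) + 'C(6 + 5 * M, 2) = 25 * a + 25 * b)%N.
  by rewrite !binE ea eb !binS2 bin0n; lia.
have e6 : ('C(6 + 5 * M, 2) + 'C(7 + 5 * M, 2) = 1 + (15 * b + 35 * a))%N.
  by rewrite !binE ea eb !binS2 bin0n; lia.
have e7 : ('C(7 + 5 * M, 2) + 'C(8 + 5 * M, 2) = 4 + (5 * b + 45 * a))%N.
  by rewrite !binE ea eb !binS2 bin0n; lia.
rewrite [('C(4 + _, 2) + 'C(3 + _, 2))%N]addnC.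
rewrite [('C(5 + _, 2) + 'C(4 + _, 2))%N]addnC.
rewrite [('C(6 + _, 2) + 'C(5 + _, 2))%N]addnC.
rewrite [('C(7 + _, 2) + 'C(6 + _, 2))%N]addnC.
rewrite [('C(8 + _, 2) + 'C(7 + _, 2))%N]addnC e3 e4 e5 e6 e7.
rewrite [(25 * b + _)%N]addnC !sgnE !exprS ?expr0.
move: ((-1) ^+ M) ('X^(25 * a + 25 * b)) => sgn x25.
move: ('X^(5 * a + 45 * b)) ('X^(15 * a + 35 * b)) => x5 x15.
move: ('X^(5 * b + 45 * a)) ('X^(15 * b + 35 * a)) => y5 y15.
ring.
Qed.

Definition section5 (L s : nat) (A : {poly int}) : {poly int} :=
  \poly_(i < L) A`_(5 * i + s).

(** A factor in x^5 preserves residues mod 5, so it passes through the section. Induction on [G] in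
    Horner form. *)
Lemma coef_section5 L s A G i : (i < L)%N -> (s < 5)%N ->
  (section5 L s A * G)`_i = (A * (G \Po 'X^5))`_(5 * i + s).
Proof.
move=> lt_iL lt_s5; elim/poly_ind: G i lt_iL => [|G c IHG] i lt_iL.
  by rewrite comp_poly0 !mulr0 !coef0.
rewrite comp_poly_MXaddC !mulrDr.
rewrite (mulrA (section5 _ _ _)) (mulrA A) !coefD !coefMC.
rewrite coefMX coefMXn coef_poly lt_iL; congr (_ + _).
case: i lt_iL => [|i] lt_iL /=; first by rewrite muln0 add0n lt_s5.
rewrite IHG ?(ltnW lt_iL) // ifF; last by lia.
by congr (_`_ _); lia.
Qed.

Lemma coefXn_comp5 t s (G : {poly int}) i : (t < 5)%N -> (s < 5)%N ->
  ('X^t * (G \Po 'X^5))`_(5 * i + s) = (t == s)%:R * G`_i.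
Proof.
move=> lt_t5 lt_s5; rewrite coefXnM; case: ltnP => [lt|le_t].
  by rewrite (_ : t == s = false) ?mul0r //; apply/eqP => e; lia.
rewrite coef_comp_poly_Xn //; have [->|ne] := eqVneq t s.
  by rewrite addnK dvdn_mulr // mulKn // mul1r.
rewrite mul0r ifF //; apply/negP => /dvdnP[k]; move/eqP: ne; lia.
Qed.

(** * From coefficient sequences to polynomials *)

Lemma qpoch_coef j L i : (0 < j)%N -> (i <= L)%N ->
  qpoch j i = (qfact 'X^j L)`_i.
Proof.
move=> j_gt0 le_iL; rewrite -(qpoch_stable j_gt0 le_iL) big_add1 big_mkord.
by under eq_bigr => k _ do rewrite exprM.
Qed.

Definition agree (K : nat) (a : fps) (p : {poly int}) : Prop :=
  forall i, (i < K)%N -> a i = p`_i.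

Lemma agreeM K a b p q :
  agree K a p -> agree K b q -> agree K (fps_mul a b) (p * q).
Proof.
move=> ap bq i lt_iK; rewrite coefM; apply: eq_bigr => j _.
by rewrite ap ?bq // (leq_ltn_trans _ lt_iK) ?leq_subr // -ltnS.
Qed.

Lemma agree_sqr K a p : agree K a p -> agree K (fps_exp a 2) (p ^+ 2).
Proof.
move=> ap; rewrite expr2 -[X in _ * X]mulr1; apply: agreeM => //.
apply: agreeM => //.
by move=> i _; rewrite coef1.
Qed.

Lemma agree_eqpX K a p q : agree K a p -> agree K a q -> eqpX K p q.
Proof. by move=> ap aq i lt_iK; rewrite -ap ?aq. Qed.

Lemma agree_poly K (a : fps) : agree K a (\poly_(i < K) a i).
Proof. by move=> i lt_iK; rewrite coef_poly lt_iK. Qed.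

Lemma agree_div K a b p q : b 0%N = 1 -> agree K a p -> agree K b q ->
  eqpX K ((\poly_(i < K) fps_div a b i) * q) p.
Proof.
move=> b0 ap bq; set I := \poly_(i < K) fps_inv b i.
have bI : eqpX K (q * I) 1.
  apply: (@agree_eqpX _ (fps_mul b (fps_inv b))).
    by apply: agreeM => //; apply: agree_poly.
  by move=> i _; rewrite fps_mulV // coef1.
rewrite -[X in eqpX _ _ X]mulr1.
apply: eqpX_trans _ (eqpXM (@eqpX_refl _ p) bI).
rewrite mulrCA mulrC; apply: eqpXM => //.
apply: (@agree_eqpX _ (fps_div a b)); first exact: agree_poly.
by apply: agreeM => //; apply: agree_poly.
Qed.

Lemma prod_ord_mul (R : comNzRingType) d M (F : nat -> R) :
  \prod_(k < d * M) F k = \prod_(k < M) \prod_(i < d) F (d * k + i)%N.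
Proof.
elim: M => [|M IHM]; first by rewrite muln0 !big_ord0.
by rewrite mulnSr big_split_ord big_ord_recr /= IHM.
Qed.

(** Finite form of f_1^2/f_2 as a triple product: the factors with even exponents are shared out,
    those with odd exponents squared. The unreduced ['X^1] and [1 + 1] match [jacobi_eqpX] at p = q
    = 1. *)
Lemma sqr_qfact_even N : qfact 'X (2 * N) ^+ 2 = 
  (\prod_(k < N) ((1 - 'X^1 * 'X^(1 + 1) ^+ k) * (1 - 'X^1 * 'X^(1 + 1) ^+ k)
                  * (1 - 'X^(1 + 1) ^+ k.+1))) * qfact 'X^2 N :> {poly int}.
Proof.
rewrite /qfact (prod_ord_mul 2 N (fun k => 1 - 'X ^+ k.+1)) -prodrXl -big_split /=.
apply: eq_bigr => k _.
rewrite big_ord_recl big_ord1 /= /bump /= !addn0 addn1.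
rewrite -!exprM mulnS !exprS !expr0 !mulr1; ring.
Qed.

(** Multiplied by f_2, both sides become f_1^2. N and L are independent because the dissection and
    the positivity argument prescribe different cutoffs. *)
Lemma eta_quotient_eqpX K N L : (K <= N)%N -> (K <= L)%N ->
  eqpX K ((\poly_(i < K) a_12_2m1_5m2 i) * (qfact 'X L ^+ 2 \Po 'X^5)) 
         (theta 'X 'X N).
Proof.
move=> le_KN le_KL; apply: (@eqpX_cancel _ (qfact 'X^2 N)).
  exact: coef0_qfact.
have agr j n : (0 < j)%N -> (K <= n)%N -> agree K (qpoch j) (qfact 'X^j n).
  by move=> j_gt0 le_Kn i lt_iK; apply: qpoch_coef; lia.
have eJ := eqpXW le_KN (@jacobi_eqpX 1 1 N isT).
apply: eqpX_trans _ (eqpXM eJ (@eqpX_refl _ _)).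
rewrite -sqr_qfact_even -mulrA [X in _ * X]mulrC.
have -> : qfact 'X L ^+ 2 \Po 'X^5 = qfact 'X^5 L ^+ 2 :> {poly int}.
  rewrite rmorphXn /= /qfact rmorph_prod; congr (_ ^+ 2).
  by apply: eq_bigr => k _; rewrite rmorphB rmorph1 rmorphXn /= comp_polyX.
apply: agree_div; first exact: eta_denominator0.
  by apply/agree_sqr/(agr 1%N) => //; lia.
by apply: agreeM; [apply: agr|apply/agree_sqr/agr].
Qed.

(** * Positivity of the sections *)

Definition nonneg (K : nat) (p : {poly int}) : Prop :=
  forall i, (i < K)%N -> 0 <= p`_i.

(** Each coefficient of [B] is that of the product plus the coefficient of [B] found k places
    earlier, if any. *)
Lemma nonneg_div1subXn K k B :
  (0 < k)%N -> nonneg K (B * (1 - 'X^k)) -> nonneg K B.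
Proof.
move=> k_gt0 B_ge0; elim/ltn_ind => i IHi lt_iK; have := B_ge0 i lt_iK.
rewrite mulrBr mulr1 coefB coefMXn; case: ltnP => [_|le_ki].
  by rewrite subr0.
rewrite subr_ge0; apply: le_trans; apply: IHi; lia.
Qed.

Lemma nonneg_div_prod K (I : Type) (r : seq I) (F : I -> {poly int}) :
  (forall i B, nonneg K (B * F i) -> nonneg K B) ->
  forall B, nonneg K (B * \prod_(i <- r) F i) -> nonneg K B.
Proof.
move=> divF; elim: r => [|i r IHr] B; first by rewrite big_nil mulr1.
by rewrite big_cons mulrA => /IHr/divF.
Qed.

(** The coefficients of [B] are the partial sums of those of [B * (1 - 'X)]. *)
Lemma pos_div1subX n B : 0 < (B * (1 - 'X))`_0 -> nonneg n.+1 (B * (1 - 'X)) ->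
  0 < B`_n.
Proof.
set C := B * _ => C0 C_ge0; have CE i : C`_i.+1 = B`_i.+1 - B`_i.
  by rewrite /C mulrBr mulr1 coefB coefMX.
have B0 : B`_0 = C`_0 by rewrite /C mulrBr mulr1 coefB coefMX subr0.
elim: n C_ge0 => [|n IHn] C_ge0; first by rewrite B0.
apply: lt_le_trans (IHn _) _; first by move=> i lt_in; apply: C_ge0; lia.
by rewrite -subr_ge0 -CE C_ge0.
Qed.

(* The multiset p, q, 10, 1, l lists every residue mod 10 twice: p, q, 10 are
   the factors of theta, and 1 provides the 1 - 'X that makes positivity strict. *)
Lemma theta_quotient_pos n p q (c : int) (l : seq nat) (B : {poly int}) :
  0 < c -> (0 < p)%N -> (0 < q)%N -> (p + q = 10)%N ->
  perm_eq [:: p, q, 10, 1 & l]%N (iota 1 10 ++ iota 1 10) ->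
  eqpX n.+1 (B * qfact 'X (10 * n.+1) ^+ 2) (c%:P * theta 'X^p 'X^q n.+1) ->
  0 < B`_n.
Proof.
move=> c_gt0 p_gt0 q_gt0 epq perm_l eB.
pose V k : {poly int} := \prod_(i <- l) (1 - 'X^(10 * k + i)).
pose J : {poly int} := \prod_(k < n.+1) ((1 - 'X^p * 'X^(p + q) ^+ k) *
  (1 - 'X^q * 'X^(p + q) ^+ k) * (1 - 'X^(p + q) ^+ k.+1)).
have l_gt0 : all (leq 1) l.
  have := perm_all (leq 1) perm_l; rewrite [X in _ = X]/=.
  by move=> /= /and3P[_ _ ->].
(* The exponents are cut into blocks of ten, each occurring twice in the square; [perm_l] regroups a
   block into three factors of [J], the one of residue 1, and [V k]. *)
have factE : qfact 'X (10 * n.+1) ^+ 2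
    = \prod_(k < n.+1) ((1 - 'X^(10 * k + 1)) * V k) * J.
  rewrite /qfact (prod_ord_mul 10 n.+1 (fun k => 1 - 'X ^+ k.+1)).
  rewrite -prodrXl -big_split; apply: eq_bigr => k _ /=.
  have -> : \prod_(i < 10) (1 - 'X ^+ (10 * k + i).+1) =
     \prod_(i <- iota 1 10) (1 - 'X^(10 * k + i)) :> {poly int}.
    rewrite (big_addn 0 11 1) big_mkord.
    by apply: eq_bigr => i _; rewrite addnA addn1.
  rewrite expr2 -big_cat -(perm_big _ perm_l) !big_cons /V epq.
  rewrite -!exprM -!exprD mulnSr [(p + _)%N]addnC [(q + _)%N]addnC /=; ring.
have coefJ : J`_0 = 1.
  rewrite coef0_prod big1 // => k _.
  by rewrite -!exprM -!exprD !coef0M !coef0_1subXn ?mulr1 //; lia.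
(* The residue 1 factor of block 0 is [1 - 'X] itself; it is left out here to stay with [B]. *)
pose U : {poly int} :=
  V 0%N * \prod_(k < n) ((1 - 'X^(10 * k.+1 + 1)) * V k.+1).
have eW : eqpX n.+1 (B * (1 - 'X) * U) c%:P.
  apply: (eqpX_cancel coefJ).
  have <- : B * qfact 'X (10 * n.+1) ^+ 2 = B * (1 - 'X) * U * J.
    by rewrite factE big_ord_recl /= -!mulrA.
  apply: eqpX_trans eB _; apply: eqpXM => //; apply: eqpX_sym.
  exact: jacobi_eqpX.
have V0 k : (V k)`_0 = 1.
  rewrite /V; elim: (l) l_gt0 => [|i r IHr] /=; first by rewrite big_nil coef1.
  case/andP=> i_gt0 r_gt0.
  by rewrite big_cons coef0M IHr // coef0_1subXn //; lia.
have U0 : U`_0 = 1.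
  rewrite /U coef0M V0 mul1r coef0_prod big1 // => k _.
  by rewrite coef0M V0 mulr1 coef0_1subXn // addn1.
apply: pos_div1subX.
  by have := eW 0%N isT; rewrite coef0M U0 mulr1 coefC => ->.
have divV k C : nonneg n.+1 (C * V k) -> nonneg n.+1 C.
  rewrite /V; elim: (l) l_gt0 C => [|i r IHr] /=.
    by move=> _ C; rewrite big_nil mulr1.
  case/andP=> i_gt0 r_gt0 C; rewrite big_cons mulrA => /(IHr r_gt0).
  by apply: nonneg_div1subXn; lia.
have : nonneg n.+1 (B * (1 - 'X) * U).
  by move=> i lt_in; rewrite eW // coefC; case: ifP => // _; apply: ltW.
rewrite /U mulrA => /nonneg_div_prod divW.
apply: (divV 0%N); apply: divW => k C.
by rewrite mulrA => /divV; apply: nonneg_div1subXn; lia.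
Qed.

Theorem theorem5p4 (n : nat) :
  [/\ 0 < a_12_2m1_5m2 (5 * n)%N,
      a_12_2m1_5m2 (5 * n + 1)%N < 0,
      a_12_2m1_5m2 (5 * n + 2)%N = 0,
      a_12_2m1_5m2 (5 * n + 3)%N = 0
    & 0 < a_12_2m1_5m2 (5 * n + 4)%N].
Proof.
pose F : {poly int} := qfact 'X (10 * n.+1) ^+ 2.
pose A := \poly_(i < 5 * n.+1) a_12_2m1_5m2 i.
(* The cutoff has the form 5M + 2 of [theta_dissection], with M = n + 1. *)
have eA : eqpX (5 * n.+1) (A * (F \Po 'X^5)) (theta 'X 'X (5 * n.+1).+2).
  by apply: eta_quotient_eqpX; lia.
have aE s : (s < 5)%N -> a_12_2m1_5m2 (5 * n + s)%N = (section5 n.+1 s A)`_n.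
  by move=> lt_s5; rewrite coef_poly ltnSn coef_poly ifT //; lia.
have thetaE p q : theta 'X^(5 * p) 'X^(5 * q) n.+1
    = theta 'X^p 'X^q n.+1 \Po 'X^5 :> {poly int}.
  by rewrite theta_rmorph !exprM !rmorphXn /= !comp_polyX.
have F0 : F`_0 = 1.
  by rewrite /F expr2 coef0M (@coef0_qfact 1).
have eS s i : (s < 5)%N -> (i < n.+1)%N -> (section5 n.+1 s A * F)`_i =
    (0%N == s)%:R * (theta 'X^5 'X^5 n.+1)`_i
    - (1%N == s)%:R * (theta 'X^3 'X^7 n.+1)`_i *+ 2
    + (4%N == s)%:R * (theta 'X^1 'X^9 n.+1)`_i *+ 2.
  move=> lt_s5 lt_in; rewrite coef_section5 // eA; last by lia.
  rewrite theta_dissection (thetaE 5%N 5%N) (thetaE 3%N 7%N) (thetaE 1%N 9%N).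
  have e0 := @coefXn_comp5 0 s (theta 'X^5 'X^5 n.+1) i isT lt_s5.
  have e1 := @coefXn_comp5 1 s (theta 'X^3 'X^7 n.+1) i isT lt_s5.
  have e4 := @coefXn_comp5 4 s (theta 'X^1 'X^9 n.+1) i isT lt_s5.
  rewrite expr0 mul1r in e0; rewrite expr1 in e1.
  rewrite ['X *+ 2 * _]mulrnAl ['X^4 *+ 2 * _]mulrnAl.
  by rewrite coefD coefB !coefMn e0 e1 e4.
have zero s : s \in [:: 2; 3]%N -> a_12_2m1_5m2 (5 * n + s)%N = 0.
  move=> s23; have lt_s5 : (s < 5)%N by move: s23; rewrite !inE => /orP[]/eqP->.
  rewrite aE //.
  suff /(_ n (ltnSn n)) -> : eqpX n.+1 (section5 n.+1 s A) 0 by rewrite coef0.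
  apply: (eqpX_cancel F0) => i lt_in; rewrite eS // mul0r coef0.
  by move: s23; rewrite !inE => /orP[]/eqP->;
    rewrite /= ?mulr0n ?mulr1n ?mul0r ?mul0rn ?mul1r
    ?subr0 ?sub0r ?add0r ?addr0.
split; [| |exact: zero|exact: zero|].
- rewrite -[(5 * n)%N]addn0 aE //.
  (* Here and below, the list is two copies of 1, ..., 10 with p, q, 10, 1 removed. *)
  apply: (@theta_quotient_pos n 5 5 1
    [:: 1; 2; 2; 3; 3; 4; 4; 6; 6; 7; 7; 8; 8; 9; 9; 10]%N) => //.
  move=> i lt_in; rewrite eS // coefCM.
  by rewrite /= ?mulr0n ?mulr1n ?mul0r ?mul0rn ?mul1r
    ?subr0 ?sub0r ?add0r ?addr0.
(* This section carries the factor -2, so its negative is shown positive. *)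
- rewrite -oppr_gt0 aE // -coefN.
  apply: (@theta_quotient_pos n 3 7 2
    [:: 1; 2; 2; 3; 4; 4; 5; 5; 6; 6; 7; 8; 8; 9; 9; 10]%N) => //.
  move=> i lt_in; rewrite mulNr coefN eS // coefCM.
  by rewrite /= ?mulr0n ?mulr1n ?mul0r ?mul0rn ?mul1r
    ?subr0 ?sub0r ?add0r ?addr0 opprK mulr_natl.
- rewrite aE //.
  apply: (@theta_quotient_pos n 1 9 2
    [:: 2; 2; 3; 3; 4; 4; 5; 5; 6; 6; 7; 7; 8; 8; 9; 10]%N) => //.
  move=> i lt_in; rewrite eS // coefCM.
  by rewrite /= ?mulr0n ?mulr1n ?mul0r ?mul0rn ?mul1r
    ?subr0 ?sub0r ?add0r ?addr0 mulr_natl.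
Qed.
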